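(* Let $K$ be a primitive quartic CM field whose real quadratic subfield $K_0$ has class number one, and let $\Phi$ be a CM-type of $K$. Let $\ell$ be a prime and $\mathfrak{l}\subset\mathcal{O}_{K_0}$ a prime ideal of norm $\ell$. Let $A=\mathbb{C}^2/\Phi(\Lambda)$ be an abelian surface over $\mathbb{C}$ with complex multiplication by an order $\mathcal{O}\subset K$ containing $\mathcal{O}_{K_0}$, where $\Lambda=\Lambda_1+\Lambda_2\tau$ with $\Lambda_1,\Lambda_2$ fractional ideals of $\mathcal{O}_{K_0}$ and $\tau\in K\setminus K_0$. A set of representatives of the (nontrivial) cyclic subgroups of $(\mathfrak{l}^{-1}\Lambda)/\Lambda$, and more precisely of the isogenies on $A$ having these subgroups as kernels, is given by $$\{I_\infty\}\cup\{I_\rho : \rho\in\Lambda_1\Lambda_2^{-1}/\mathfrak{l}\Lambda_1\Lambda_2^{-1}\},$$ where $$I_\infty: A\to\mathbb{C}^2/\Phi(\mathfrak{l}^{-1}\Lambda_1+\Lambda_2\tau),\ z\mapsto z,\qquad I_\rho: A\to\mathbb{C}^2/\Phi(\Lambda_1+\mathfrak{l}^{-1}\Lambda_2(\tau+\rho)),\ z\mapsto z.$$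
   Context: A quartic CM field is primitive if it contains no imaginary quadratic subfield. A CM-type $\Phi=(\phi_1,\phi_2)$ is a pair of non-complex-conjugate embeddings $K\to\mathbb{C}$; $\Phi(x)=(\phi_1(x),\phi_2(x))\in\mathbb{C}^2$ for $x\in K$. Sums such as $\Lambda_1+\Lambda_2\tau$ denote the $\mathcal{O}_{K_0}$-submodule of $K$ they generate. The maps $z\mapsto z$ are the isogenies induced by the identity of $\mathbb{C}^2$; their kernels are viewed inside $\Phi(\mathfrak{l}^{-1}\Lambda)/\Phi(\Lambda)\subset A$. *)

(* Defs.v *)
From HB Require Import structures.
From mathcomp Require Import all_boot all_order all_algebra all_field.
From mathcomp Require Import generic_quotient ring_quotient mxpoly.
From mathcomp Require Import complex.
From mathcomp Require Import all_classical all_reals.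

Set Implicit Arguments.
Unset Strict Implicit.
Unset Printing Implicit Defensive.

Import Order.TTheory GRing.Theory Num.Theory.

Local Open Scope classical_set_scope.
Local Open Scope ring_scope.
Local Open Scope quotient_scope.

(* Number fields are finite extensions of rat, and the complex numbers are
   R[i] for an arbitrary R : realType. *)

Section NumberFields.
Variable R : realType.

Definition totally_real (L : fieldExtType rat) : Prop :=
  forall (f : {rmorphism L -> R[i]}) (x : L), f x \is Num.real.

Definition totally_imaginary (L : fieldExtType rat) : Prop :=
  forall f : {rmorphism L -> R[i]}, exists x : L, f x \isn't Num.real.

Variable K : fieldExtType rat.

Definition real_quadratic (F : {subfield K}) : Prop :=
  \dim F = 2 /\ totally_real (subvs_of F).

Definition imaginary_quadratic (F : {subfield K}) : Prop :=
  \dim F = 2 /\ totally_imaginary (subvs_of F).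

Definition CM_field : Prop :=
  totally_imaginary K /\
  exists F : {subfield K},
    totally_real (subvs_of F) /\ \dim {:K} = (2 * \dim F)%N.

Definition primitive_quartic_CM_field : Prop :=
  [/\ CM_field, \dim {:K} = 4
    & ~ exists F : {subfield K}, imaginary_quadratic F].

(* With [K : Q] = 4, the two conditions say that the embeddings of K into the
   complex numbers are phi 0, phi 1 and their conjugates. *)
Definition CM_type (phi : 'I_2 -> {rmorphism K -> R[i]}) : Prop :=
  ~ (phi 0 =1 phi 1) /\ ~ (phi 0 =1 fun x => (phi 1 x)^*).

Definition is_order (O : {pred K}) : Prop :=
  [/\ 1 \in O, {in O &, forall x y, x - y \in O},
      {in O &, forall x y, x * y \in O}
    & exists b : (\dim {:K}).-tuple K, basis_of {:K} b /\
        forall x, x \in O <->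
          exists c : 'I_(\dim {:K}) -> int, x = \sum_i tnth b i *~ c i].

End NumberFields.

Section Modules.
Variables (K : fieldExtType rat) (K0 : {subfield K}).

Definition ring_of_integers : {pred K} :=
  fun x => (x \in K0) && `[< integralOver (intr : int -> K) x >].

Definition omod_closed (S : {pred K}) : Prop :=
  zmod_closed S /\ forall a x, a \in ring_of_integers -> x \in S -> a * x \in S.

(* The O_{K0}-submodules of K. *)
Record omod := OMod { omod_fun : K -> bool; omodP : omod_closed omod_fun }.

Coercion omod_pred (L : omod) : {pred K} := omod_fun L.

HB.instance Definition _ (L : omod) :=
  GRing.isZmodClosed.Build K (omod_pred L) (proj1 (omodP L)).

Definition span_pred (S : set K) : {pred K} :=
  fun x => `[< forall L : omod, (forall s, S s -> s \in L) -> x \in L >].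

Lemma span_closed (S : set K) : omod_closed (span_pred S).
Proof.
split; [split=> [|x y]|move=> a x aO]; rewrite -!topredE /= /span_pred.
- by apply/asboolP => L _; exact: rpred0.
- move=> /asboolP Sx /asboolP Sy; apply/asboolP => L SL.
  by rewrite rpredB ?Sx ?Sy.
- move=> /asboolP Sx; apply/asboolP => L SL.
  by apply: (proj2 (omodP L)) => //; exact: Sx.
Qed.

Definition omod_span (S : set K) : omod := OMod (span_closed S).

Definition omod_add (L M : omod) : omod := omod_span ([set` L] `|` [set` M]).

Definition omod_mul (L M : omod) : omod :=
  omod_span [set z | exists x y, [/\ x \in L, y \in M & z = x * y]].

Definition omod_scale (L : omod) (t : K) : omod :=
  omod_span [set x * t | x in [set` L]].

Definition omod_inv (I : omod) : omod :=
  omod_span [set x | x \in K0 /\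
                     forall y, y \in I -> x * y \in ring_of_integers].

Definition fractional_ideal (I : omod) : Prop :=
  [/\ {subset I <= K0}, exists2 x, x \in I & x != 0
    & exists d, [/\ d \in ring_of_integers, d != 0
                  & forall x, x \in I -> d * x \in ring_of_integers]].

Definition ideal_equiv (I J : omod) : Prop :=
  exists a, [/\ a \in K0, a != 0 & J =i omod_scale I a].

Definition ideal_class (I : omod) : set omod :=
  [set J | fractional_ideal J /\ ideal_equiv I J].

Definition class_number_eq (n : nat) : Prop :=
  ([set ideal_class I | I in fractional_ideal] #= `I_n)%card.

(* The zero ideal is not excluded here; it is excluded by a finite norm. *)
Definition prime_ideal (I : omod) : Prop :=
  [/\ {subset I <= ring_of_integers}, 1 \notin I
    & {in ring_of_integers &, forall x y,
        x * y \in I -> x \in I \/ y \in I}].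

(* The image of M in K / N, i.e. the quotient M / N when N is included in M. *)
Definition quotient_set (M N : omod) : set (Quotient.quot N) :=
  [set \pi_(Quotient.quot N) x | x in [set` M]].

Definition ideal_norm_eq (I : omod) (n : nat) : Prop :=
  ([set \pi_(Quotient.quot I) x | x in [set` ring_of_integers]] #= `I_n)%card.

End Modules.

Arguments quotient_set {K K0} M N _.

Declare Scope omod_scope.
Delimit Scope omod_scope with OM.
Bind Scope omod_scope with omod.
Notation "L + M" := (omod_add L M) : omod_scope.
Notation "L * M" := (omod_mul L M) : omod_scope.
Notation "L *: t" := (omod_scale L t%R) : omod_scope.
Notation "I ^-1" := (omod_inv I) : omod_scope.

Notation torus L := (Quotient.quot L).

Section ComplexTori.
Variable R : realType.
Local Notation V := 'cV[R[i]]_2.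

Definition full_lattice (L : {pred V}) : Prop :=
  (exists2 e : R, 0 < e &
     forall z, z \in L -> (forall j, `|z j 0| < e%:C%C) -> z = 0) /\
  (forall z : V, exists (n : nat) (v : 'I_n -> V) (c : 'I_n -> R),
     (forall k, v k \in L) /\ z = \sum_(k < n) (c k)%:C%C *: v k).

Definition riemann_form (L : {pred V}) (E : V -> V -> R) : Prop :=
  [/\ forall (a : R) u v w, E (a%:C%C *: u + v) w = a * E u w + E v w,
      forall u v, E u v = - E v u,
      {in L &, forall u v, E u v \is a Num.int},
      forall u v, E ('i *: u) ('i *: v) = E u v
    & forall u, u != 0 -> 0 < E ('i *: u) u].

(* C^2 / L is an abelian surface: a complex torus admitting a polarization. *)
Definition abelian_surface (L : {pred V}) : Prop :=
  full_lattice L /\ exists E, riemann_form L E.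

(* End(C^2 / L), given by its analytic representation. *)
Definition End_torus (L : {pred V}) : set 'M[R[i]]_2 :=
  [set M | forall z, z \in L -> M *m z \in L].

Definition has_CM_by (L : {pred V}) (K : fieldExtType rat) (O : {pred K}) :
    Prop :=
  exists f : K -> 'M[R[i]]_2,
    [/\ f 1 = 1, {in O &, {morph f : x y / x + y}},
        {in O &, {morph f : x y / x * y >-> x *m y}}
      & set_bij [set` O] (End_torus L) f].

Definition torus_hom (L L' : zmodClosed V) (f : torus L -> torus L') : Prop :=
  exists M : 'M[R[i]]_2, forall z, f (\pi_(torus L) z) = \pi_(torus L') (M *m z).

Definition torus_iso (L L' : zmodClosed V) (f : torus L -> torus L') : Prop :=
  torus_hom f /\
  exists g : torus L' -> torus L, [/\ torus_hom g, cancel f g & cancel g f].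

Definition kernel (S T : zmodType) (f : S -> T) : set S := [set x | f x = 0].

Definition isogeny (L L' : zmodClosed V) (f : torus L -> torus L') : Prop :=
  [/\ abelian_surface L, abelian_surface L', torus_hom f,
      (forall y, exists x, f x = y) & finite_set (kernel f)].

Definition isogeny_equiv (L L1 L2 : zmodClosed V) (f1 : torus L -> torus L1)
    (f2 : torus L -> torus L2) : Prop :=
  exists2 g : torus L1 -> torus L2, torus_iso g & f2 =1 g \o f1.

(* The map z |-> z from C^2 / L to C^2 / L'.  It is computed on arbitrary
   representatives, so it is only meaningful when L is included in L'. *)
Definition torus_id (L L' : zmodClosed V) : torus L -> torus L' :=
  fun x => \pi_(torus L') (repr x).

Definition nontrivial_cyclic_subgroups (T : zmodType) (G : set T) :
    set (set T) :=
  [set H | [/\ exists g : T, H = range (fun n : int => g *~ n),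
               H `<=` G & H <> [set 0]]].

End ComplexTori.

Arguments torus_id {R} L L' _.

Section PhiLattice.
Variables (R : realType) (K : fieldExtType rat) (K0 : {subfield K}).
Variable phi : 'I_2 -> {rmorphism K -> R[i]}.

Definition Phi (x : K) : 'cV[R[i]]_2 := \col_j phi j x.

Definition Phi_lattice (L : omod K0) : {pred 'cV[R[i]]_2} :=
  fun z => `[< exists2 x, x \in L & z = Phi x >].

Lemma Phi_lattice_closed (L : omod K0) : zmod_closed (Phi_lattice L).
Proof.
split; rewrite -?topredE /= /Phi_lattice.
  apply/asboolP; exists 0; first exact: rpred0.
  by apply/colP => j; rewrite !mxE rmorph0.
move=> z w /asboolP[x xL ->] /asboolP[y yL ->]; apply/asboolP.
exists (x - y); first by rewrite rpredB.
by apply/colP => j; rewrite !mxE rmorphB.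
Qed.

HB.instance Definition _ (L : omod K0) :=
  GRing.isZmodClosed.Build _ (Phi_lattice L) (Phi_lattice_closed L).

(* The subset Phi(M) / Phi(L) of the torus C^2 / Phi(L). *)
Definition Phi_quotient (M L : omod K0) : set (torus (Phi_lattice L)) :=
  [set \pi_(torus (Phi_lattice L)) z | z in [set` Phi_lattice M]].

End PhiLattice.

Arguments Phi_quotient {R K K0} phi M L _.

Section Targets.
Variables (K : fieldExtType rat) (K0 : {subfield K}).
Variables (l L1 L2 : omod K0) (tau : K).

Definition target_infty : omod K0 := (l^-1 * L1 + L2 *: tau)%OM.

Definition target_rho (rho : K) : omod K0 :=
  (L1 + (l^-1 * L2) *: (tau + rho))%OM.

Definition rho_numer : omod K0 := (L1 * L2^-1)%OM.
Definition rho_denom : omod K0 := (l * (L1 * L2^-1))%OM.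

(* None stands for infinity, and a class rho for any of its representatives. *)
Definition isog_index : Type := option (Quotient.quot rho_denom).

Definition isog_indices : set isog_index :=
  [set None] `|` [set Some c | c in quotient_set rho_numer rho_denom].

Definition target (i : isog_index) : omod K0 :=
  if i is Some c then target_rho (repr c) else target_infty.

Definition isog (R : realType) (phi : 'I_2 -> {rmorphism K -> R[i]})
    (L : omod K0) (i : isog_index) :
    torus (Phi_lattice phi L) -> torus (Phi_lattice phi (target i)) :=
  torus_id (Phi_lattice phi L) (Phi_lattice phi (target i)).

End Targets.

Arguments isog_index {K K0} l L1 L2.
Arguments isog_indices {K K0} l L1 L2 _.
Arguments target {K K0} {l L1 L2} tau i.
Arguments isog {K K0} {l L1 L2} tau {R} phi L i _.

(* Main.v *)
(* Class number one makes L1, L2 and l principal, generated by a, b and lam.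
   Then (u, v) |-> lam^-1 (a u + b v tau) identifies l^-1 L / L with (OK0 / l)^2,
   a plane over OK0 / l.  Since OK0 / l has ell elements it is F_ell, so the
   nontrivial cyclic subgroups are the lines of that plane.  The targets
   of the isogenies I_i are exactly the preimages of these lines, with slope
   rho = (a / b) r corresponding to the line through (r, 1).  An isogeny is
   determined by its kernel up to isomorphism of the target. *)
From HB Require Import structures.
Require Import Defs.
From mathcomp Require Import all_boot all_order all_algebra all_field.
From mathcomp Require Import generic_quotient ring_quotient mxpoly.
From mathcomp Require Import complex ring.
From mathcomp Require Import all_classical all_reals.

Set Implicit Arguments.
Unset Strict Implicit.
Unset Printing Implicit Defensive.

Import Order.TTheory GRing.Theory Num.Theory.

Local Open Scope classical_set_scope.
Local Open Scope ring_scope.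
Local Open Scope quotient_scope.

(** * Preliminaries on additive subgroups and finite sets *)

(** If [p] did not divide [n], a Bezout relation would write 1 as an integer combination of two
    elements of [S]. *)
Lemma prime_dvd_natr (A : pzRingType) (S : zmodClosed A) (p n : nat) :
  prime p -> p%:R \in S -> 1 \notin S -> n%:R \in S -> (p %| n)%N.
Proof.
move=> p_prime pS S1 nS; apply: contraR S1; rewrite -prime_coprime // => cpn.
have p_gt0 := prime_gt0 p_prime.
case: (egcdnP n p_gt0) => u v def_g _.
have /eqP cpn1 := cpn; rewrite cpn1 in def_g.
have -> : 1 = p%:R *+ u - n%:R *+ v :> A.
  by rewrite -!mulrnA mulnC def_g natrD mulnC addrAC subrr add0r.
by apply: rpredB; apply: rpredMn.
Qed.

Lemma pi_quotP (V : zmodType) (S : zmodClosed V) (x y : V) :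
  \pi_(Quotient.quot S) x = \pi_(Quotient.quot S) y <-> x - y \in S.
Proof. by rewrite Quotient.idealrBE; split=> /eqP. Qed.

Lemma card_eq_seq (T : choiceType) (A : set T) (n : nat) : (A #= `I_n)%card ->
  exists s : seq T, [/\ uniq s, size s = n & A = [set` s]].
Proof.
move=> An; have Afin : finite_set A by apply/finite_setP; exists n.
exists (finmap.enum_fset (fset_set A)); split; first exact: finmap.fset_uniq.
- exact: card_fset_set.
- exact: esym (fset_setK Afin).
Qed.

(** * Submodules of [K] over the integers of [K0], and their generators *)

Section Modules.
Variables (K : fieldExtType rat) (K0 : {subfield K}).
Local Notation OK0 := (ring_of_integers K0).
Implicit Types (I J L M : omod K0) (a t x : K).

Lemma ringP x :
  reflect (x \in K0 /\ integralOver (intr : int -> K) x) (x \in OK0).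
Proof.
rewrite -topredE /= /ring_of_integers.
by apply: (iffP andP) => -[xK /asboolP].
Qed.

Lemma ring_sub : {subset OK0 <= K0}.
Proof. by move=> x /ringP[]. Qed.

Lemma ring1 : 1 \in OK0.
Proof. by apply/ringP; split; [exact: rpred1 | exact: integral1]. Qed.

Lemma ring0 : 0 \in OK0.
Proof. by apply/ringP; split; [exact: rpred0 | exact: integral0]. Qed.

Lemma ringB : {in OK0 &, forall x y, x - y \in OK0}.
Proof.
move=> x y /ringP[xK xi] /ringP[yK yi]; apply/ringP.
by split; [exact: rpredB | exact: integral_sub].
Qed.

Lemma ringM : {in OK0 &, forall x y, x * y \in OK0}.
Proof.
move=> x y /ringP[xK xi] /ringP[yK yi]; apply/ringP.
by split; [exact: rpredM | exact: integral_mul].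
Qed.

Definition omod_ring : omod K0 := OMod (conj (conj ring0 ringB) ringM).

Lemma mem_omod_ring x : (x \in omod_ring) = (x \in OK0).
Proof. by []. Qed.

Lemma ringD : {in OK0 &, forall x y, x + y \in OK0}.
Proof. by move=> x y xO yO; rewrite -mem_omod_ring rpredD. Qed.

Lemma ringMn x n : x \in OK0 -> x *+ n \in OK0.
Proof. by move=> xO; rewrite -mem_omod_ring rpredMn. Qed.

Lemma omodM L a x : a \in OK0 -> x \in L -> a * x \in L.
Proof. exact: (proj2 (omodP L)). Qed.

Lemma mem_span (S : set K) x : S x -> x \in omod_span K0 S.
Proof. by move=> Sx; rewrite -topredE; apply/asboolP => M; apply. Qed.

(** The closure conditions make [P] a submodule containing [S], and the span is the intersection of
    all such submodules. *)
Lemma span_ind (S : set K) (P : K -> Prop) : P 0 ->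
  (forall x y, P x -> P y -> P (x - y)) ->
  (forall a x, a \in OK0 -> P x -> P (a * x)) ->
  (forall x, S x -> P x) -> forall x, x \in omod_span K0 S -> P x.
Proof.
move=> P0 PB PM SP x.
have cl : omod_closed K0 (fun x => `[< P x >]).
  split; [split=> [|u v]|move=> a u aO]; rewrite -?topredE /=.
  - exact/asboolP.
  - by move=> /asboolP Pu /asboolP Pv; apply/asboolP/PB.
  - by move=> /asboolP Pu; apply/asboolP/PM.
rewrite -topredE /= => /asboolP/(_ (OMod cl)) h; apply/asboolP.
by apply: h => s Ss; rewrite -topredE; apply/asboolP/SP.
Qed.

(** The sums already form a submodule, so passing to the span adds nothing. *)
Lemma mem_addP L M x : x \in (L + M)%OM <->
  exists y z, [/\ y \in L, z \in M & x = y + z].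
Proof.
split; last first.
  move=> [y [z [yL zM ->]]].
  by apply: rpredD; apply: mem_span; [left|right].
move: x; apply: span_ind.
- by exists 0, 0; rewrite !rpred0 addr0.
- move=> _ _ [y [z [yL zM ->]]] [y' [z' [yL' zM' ->]]].
  by exists (y - y'), (z - z'); rewrite !rpredB // opprD addrACA.
- move=> a _ aO [y [z [yL zM ->]]].
  by exists (a * y), (a * z); rewrite !omodM // mulrDr.
- move=> x [xL|xM]; first by exists x, 0; rewrite rpred0 addr0.
  by exists 0, x; rewrite rpred0 add0r.
Qed.

Lemma mem_scaleP L t x : x \in (L *: t)%OM <-> exists2 y, y \in L & x = y * t.
Proof.
split; last by move=> [y yL ->]; apply: mem_span; exists y.
move: x; apply: span_ind.
- by exists 0; rewrite ?rpred0 ?mul0r.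
- by move=> _ _ [y yL ->] [z zL ->]; exists (y - z); rewrite ?rpredB ?mulrBl.
- by move=> a _ aO [y yL ->]; exists (a * y); rewrite ?omodM ?mulrA.
- by move=> x [y yL <-]; exists y.
Qed.

(** The generator is taken in [K0], not in [OK0], so that fractional ideals and inverses are
    covered. *)
Definition principal I a : Prop :=
  [/\ a \in K0, a != 0
    & forall x, x \in I <-> exists2 u, u \in OK0 & x = a * u].

(** There is only one class, so [I], which lies in its own class, also lies in that of [OK0]. The
    scaling factor of this equivalence is the generator. *)
Lemma class_number_one_principal I :
  class_number_eq K0 1 -> fractional_ideal I -> exists a, principal I a.
Proof.
move=> /card_eq_seq[s [_ s1 clE]] Ifrac.
have ring_frac : fractional_ideal omod_ring.
  split; first exact: ring_sub.
    by exists 1; [exact: ring1 | exact: oner_neq0].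
  by exists 1; split; [exact: ring1|exact: oner_neq0|move=> x; rewrite mul1r].
have cl_s J : fractional_ideal J -> ideal_class J \in s.
  by move=> Jf; have : [set` s] (ideal_class J) by rewrite -clE; exists J.
have E : ideal_class I = ideal_class omod_ring.
  move: (cl_s _ Ifrac) (cl_s _ ring_frac).
  case: s s1 {clE cl_s} => [|c []] //= _.
  by rewrite !mem_seq1 => /eqP-> /eqP->.
have II : ideal_class I I.
  split=> //; exists 1; split; [exact: rpred1|exact: oner_neq0|move=> x].
  apply/idP/idP => [xI|/mem_scaleP[y yI ->]]; last by rewrite mulr1.
  by apply/mem_scaleP; exists x; rewrite ?mulr1.
have := II; rewrite E => -[_ [a [aK a0 IE]]]; exists a; split=> // x.
rewrite IE mem_scaleP; split=> -[u uO ->]; exists u => //; exact: mulrC.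
Qed.

(** [J] is any submodule of [K], which allows products such as [l^-1 * L] with [L] not contained in
    [K0]. *)
Lemma mem_mul_principal I J a x : principal I a ->
  x \in (I * J)%OM <-> exists2 y, y \in J & x = a * y.
Proof.
move=> [aK a0 IP]; split; last first.
  move=> [y yJ ->]; apply: mem_span; exists a, y; split=> //.
  by apply/IP; exists 1; rewrite ?ring1 ?mulr1.
move: x; apply: span_ind.
- by exists 0; rewrite ?rpred0 ?mulr0.
- by move=> _ _ [y yL ->] [z zL ->]; exists (y - z); rewrite ?rpredB ?mulrBr.
- by move=> b _ bO [y yL ->]; exists (b * y); rewrite ?omodM // mulrCA.
- move=> _ [_ [y [/IP[u uO ->] yJ ->]]]; exists (u * y); rewrite ?omodM //.
  by rewrite mulrA.
Qed.

Lemma principal_mul I J a b : principal I a -> principal J b ->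
  principal (I * J)%OM (a * b).
Proof.
move=> pI [bK b0 JP]; have [aK a0 _] := pI; split; rewrite ?rpredM ?mulf_neq0 //.
move=> x; rewrite (mem_mul_principal _ _ pI); split.
  by move=> [_ /JP[u uO ->] ->]; exists u; rewrite ?mulrA.
by move=> [u uO ->]; exists (b * u); rewrite ?mulrA //; apply/JP; exists u.
Qed.

(** An [x] that multiplies [I] into [OK0] makes [x * a] integral, because [a] is in [I]; this puts
    [x] in [a^-1 * OK0]. *)
Lemma principal_inv I a : principal I a -> principal (I^-1)%OM a^-1.
Proof.
move=> [aK a0 IP]; split; rewrite ?rpredV ?invr_neq0 //.
move=> x; split; last first.
  move=> [u uO ->]; apply: mem_span; split.
    by apply: rpredM; [rewrite rpredV | exact: ring_sub].
  move=> _ /IP[v vO ->]; rewrite mulrACA mulVf // mul1r; exact: ringM.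
move: x; apply: span_ind.
- by exists 0; rewrite ?ring0 ?mulr0.
- by move=> _ _ [y yL ->] [z zL ->]; exists (y - z); rewrite ?ringB ?mulrBr.
- by move=> b _ bO [y yL ->]; exists (b * y); rewrite ?ringM // mulrCA.
- move=> x [xK xI]; exists (x * a); last by rewrite mulrCA mulVf ?mulr1.
  by apply: xI; apply/IP; exists 1; rewrite ?ring1 ?mulr1.
Qed.

End Modules.

(** * The residue field of a prime ideal of prime norm *)

Section PrimeIdeal.
Variables (K : fieldExtType rat) (K0 : {subfield K}).
Variables (l : omod K0) (ell : nat).
Hypotheses (ell_prime : prime ell) (l_prime : prime_ideal l).
Hypothesis l_norm : ideal_norm_eq l ell.
Local Notation OK0 := (ring_of_integers K0).

(* Adding 1 permutes the ell classes, so their sum is unchanged by ell times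
   the class of 1. *)
Lemma norm_mem : ell%:R \in l.
Proof.
have [s [s_uniq s_size sE]] := card_eq_seq l_norm.
have mem_s x : x \in s <-> exists2 u, u \in OK0 & \pi_(Quotient.quot l) u = x.
  have -> : x \in s = [set` s] x :> Prop by [].
  by rewrite -sE; split=> -[u uO <-]; exists u.
pose g : Quotient.quot l := \pi_(Quotient.quot l) 1.
pose t := [seq x + g | x <- s].
have t_uniq : uniq t by rewrite map_inj_uniq //; exact: addIr.
have t_sub : {subset t <= s}.
  move=> _ /mapP[_ /mem_s[u uO <-] ->]; apply/mem_s; exists (u + 1).
    exact/ringD/ring1.
  by rewrite /g -(raddfD (\pi_(Quotient.quot l))).
have [_ st] := uniq_min_size t_uniq t_sub (eq_leq (esym (size_map _ _))).
have : \sum_(x <- t) x = \sum_(x <- s) x.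
  exact/perm_big/(uniq_perm t_uniq s_uniq).
rewrite big_map big_split /= big_const_seq count_predT s_size iter_addr_0.
move=> /eqP.
rewrite -subr_eq0 addrAC subrr add0r /g -(raddfMn (\pi_(Quotient.quot l))).
rewrite -(raddf0 (\pi_(Quotient.quot l))).
by move=> /eqP/pi_quotP; rewrite subr0.
Qed.

(** The nonzero element required of a fractional ideal is [ell] itself. *)
Lemma prime_fractional : fractional_ideal l.
Proof.
have [l_sub _ _] := l_prime; split.
- by move=> x /l_sub /ring_sub.
- exists ell%:R; first exact: norm_mem.
  by rewrite -scaler_nat scaler_eq0 oner_eq0 pnatr_eq0 orbF -lt0n prime_gt0.
- exists 1; split; rewrite ?ring1 ?oner_neq0 // => x /l_sub; by rewrite mul1r.
Qed.

(** This expresses that [OK0 / l] is the prime field. The multiples of [u] by [0, ..., ell - 1] are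
    distinct modulo [l]: a coincidence would put some [n - m] in [l], hence make it divisible by
    [ell]. They therefore exhaust the [ell] classes. *)
Lemma prime_multiples u v : u \in OK0 -> v \in OK0 -> u \notin l ->
  exists n : nat, v - u *+ n \in l.
Proof.
move=> uO vO ul; have [_ l1 lM] := l_prime.
have [s [s_uniq s_size sE]] := card_eq_seq l_norm.
have mem_s w : w \in OK0 -> \pi_(Quotient.quot l) w \in s.
  by move=> wO; have : [set` s] (\pi_(Quotient.quot l) w) by rewrite -sE; exists w.
pose t := [seq \pi_(Quotient.quot l) (u *+ n) | n <- iota 0 ell].
have inj m n : (m <= n < ell)%N -> u *+ n - u *+ m \in l -> m = n.
  move=> /andP[mn nl]; rewrite -mulrnBr // -mulr_natr.
  have nO : (n - m)%:R \in OK0 by apply/ringMn/ring1.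
  move=> /(lM _ _ uO nO)[|]; first by rewrite (negPf ul).
  move=> /(prime_dvd_natr ell_prime norm_mem l1) dvd; apply/eqP.
  rewrite eqn_leq mn -subn_eq0; apply: contraLR dvd; rewrite -lt0n => nm_gt0.
  by rewrite gtnNdvd // (leq_ltn_trans (leq_subr _ _)).
have t_uniq : uniq t.
  rewrite map_inj_in_uniq ?iota_uniq // => m n; rewrite !mem_iota !add0n /=.
  move=> ml nl /pi_quotP D; have [mn|/ltnW nm] := leqP m n.
    by apply: inj; rewrite ?mn // -opprB rpredN.
  by apply/esym/inj; rewrite ?nm.
have t_sub : {subset t <= s}.
  move=> _ /mapP[n _ ->]; exact/mem_s/ringMn.
have [|_ ts] := uniq_min_size t_uniq t_sub.
  by rewrite size_map size_iota s_size.
have := mem_s v vO; rewrite -ts => /mapP[n _ /pi_quotP vn].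
by exists n.
Qed.

End PrimeIdeal.

(** * Complex tori, and isogenies given by their analytic representation *)

Section ComplexTori.
Variable R : realType.
Local Notation V := 'cV[R[i]]_2.
Implicit Types L M : zmodClosed V.

Lemma quot_eq0P (W : zmodType) (S : zmodClosed W) (x : W) :
  \pi_(Quotient.quot S) x = 0 <-> x \in S.
Proof. by rewrite -(raddf0 (\pi_(Quotient.quot S))) pi_quotP subr0. Qed.

Definition torus_mx (A : 'M[R[i]]_2) L M (x : torus L) : torus M :=
  \pi_(torus M) (A *m repr x).

Lemma torus_mx_pi A L M z : (forall w, w \in L -> A *m w \in M) ->
  torus_mx A M (\pi_(torus L) z) = \pi_(torus M) (A *m z).
Proof.
move=> AL; apply/pi_quotP; rewrite -mulmxBr; apply: AL.
by apply/pi_quotP; rewrite reprK.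
Qed.

Lemma torus_id_pi L M z : {subset L <= M} ->
  torus_id L M (\pi_(torus L) z) = \pi_(torus M) z.
Proof.
by move=> LM; apply/pi_quotP/LM/pi_quotP; rewrite reprK.
Qed.

Lemma kernel_torus_id L M : {subset L <= M} ->
  kernel (torus_id L M) = [set \pi_(torus L) z | z in [set` M]].
Proof.
move=> LM; apply/seteqP; split=> [x|_ [z zM <-]]; rewrite /kernel /=.
  by rewrite -[x]reprK torus_id_pi // => /quot_eq0P; exists (repr x).
by rewrite torus_id_pi //; apply/quot_eq0P.
Qed.

Lemma mulrn_eq0_col (z : V) n : (0 < n)%N -> z *+ n = 0 -> z = 0.
Proof.
move=> n0 /eqP; rewrite -scaler_nat scaler_eq0 pnatr_eq0.
by rewrite (gtn_eqF n0) => /eqP.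
Qed.

(** Discreteness passes up to [M] with radius [e / n], since [n] times a shorter vector of [M] is a
    short vector of [L]. Spanning is inherited from [L]. *)
Lemma full_lattice_sup L M n : {subset L <= M} -> (0 < n)%N ->
  (forall z, z \in M -> z *+ n \in L) -> full_lattice L -> full_lattice M.
Proof.
move=> LM n0 ML [[e e0 Le] Lspan]; split; last first.
  move=> z; have [m [v [c [vL zE]]]] := Lspan z.
  by exists m, v, c; split=> // k; apply: LM.
exists (e / n%:R); first by rewrite divr_gt0 ?ltr0n.
move=> z zM zlt; apply: (mulrn_eq0_col n0); apply: Le; first exact: ML.
move=> j; rewrite -scaler_nat mxE mulr_natl normrMn.
have -> : e = e / n%:R *+ n by rewrite -mulr_natr divfK // pnatr_eq0 -lt0n.
by rewrite rmorphMn /= ltr_pMn2r.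
Qed.

(** A polarization of [M] is the pullback of the Riemann form of [L] along multiplication by [n],
    which is integral on [M]. *)
Lemma abelian_surface_sup L M n : {subset L <= M} -> (0 < n)%N ->
  (forall z, z \in M -> z *+ n \in L) -> abelian_surface L -> abelian_surface M.
Proof.
move=> LM n0 ML [fL [E [Elin Eanti Eint Ei Epos]]].
split; first exact: (full_lattice_sup LM n0 ML fL).
exists (fun u v => E (u *+ n) (v *+ n)); split.
- by move=> a u v w; rewrite mulrnDl scalerMnr Elin.
- by move=> u v; apply: Eanti.
- by move=> u v uM vM; apply: Eint; apply: ML.
- by move=> u v; rewrite !scalerMnr Ei.
- move=> u u0; rewrite scalerMnr; apply: Epos.
  by apply: contra_neq u0; exact: mulrn_eq0_col.
Qed.

Lemma torus_id_isogeny L M n : {subset L <= M} -> (0 < n)%N ->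
  (forall z, z \in M -> z *+ n \in L) -> abelian_surface L ->
  finite_set (kernel (torus_id L M)) -> isogeny (torus_id L M).
Proof.
move=> LM n0 ML aL fin; split=> //; first exact: (abelian_surface_sup LM n0 ML aL).
- by exists 1 => z; rewrite mul1mx torus_id_pi.
- move=> y; exists (\pi_(torus L) (repr y)).
  by rewrite torus_id_pi // reprK.
Qed.

(* A lattice contains no complex line, so the analytic representation of an
   isogeny with kernel M / L is invertible. *)
Lemma isogeny_equiv_torus_id L M L' (f : torus L -> torus L') :
  {subset L <= M} -> full_lattice M -> torus_hom f ->
  kernel f = kernel (torus_id L M) -> isogeny_equiv (torus_id L M) f.
Proof.
move=> LM [[e e0 Me] _] [A fA] ker.
(* Equality of the kernels says that [M] is the preimage of [L'] under [A]. *)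
have memM z : A *m z \in L' <-> z \in M.
  rewrite -!quot_eq0P -fA -(torus_id_pi _ LM).
  have -> x : f x = 0 <-> kernel f x by [].
  by rewrite ker.
have Ainj (z : V) : A *m z = 0 -> z = 0.
  (* [S] exceeds the modulus of each coordinate of [z], so [(e / S) *: z] is shorter than every
     nonzero vector of [M]. It belongs to [M] because [A] kills it. *)
  move=> Az0; pose S := 1 + \sum_j `|z j 0|.
  have S0 : 0 < S by rewrite ltr_pwDl ?sumr_ge0.
  have t0 : 0 < e%:C%C / S by rewrite divr_gt0 // (ltcR 0).
  have /eqP : (e%:C%C / S) *: z = 0.
    apply: Me; first by apply/memM; rewrite -scalemxAr Az0 scaler0 rpred0.
    move=> j; rewrite mxE normrM (gtr0_norm t0) mulrAC ltr_pdivrMr //.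
    rewrite ltr_pM2l ?(ltcR 0) // /S (bigD1 j) //= addrCA ltrDl.
    by rewrite ltr_pwDl ?sumr_ge0.
  by rewrite scaler_eq0 (gt_eqF t0) => /eqP.
have Aunit : A \in unitmx.
  rewrite unitmxE unitfE -det_tr; apply/negP => /det0P[v v0 vA].
  have /Ainj : A *m v^T = 0 by rewrite -[A]trmxK -trmx_mul vA trmx0.
  by move=> /(congr1 trmx); rewrite trmxK trmx0; apply/eqP.
have homA w : w \in M -> A *m w \in L' by move=> /memM.
have homA' w : w \in L' -> invmx A *m w \in M.
  by move=> wL; apply/memM; rewrite mulKVmx.
exists (@torus_mx A M L'); last first.
  by move=> x; rewrite -[x]reprK /= fA torus_id_pi // (torus_mx_pi _ homA).
split; first by exists A => z; rewrite (torus_mx_pi _ homA).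
exists (@torus_mx (invmx A) L' M); split.
- by exists (invmx A) => z; rewrite (torus_mx_pi _ homA').
- move=> x; rewrite -[x]reprK (torus_mx_pi _ homA) (torus_mx_pi _ homA').
  by rewrite mulKmx.
- move=> x; rewrite -[x]reprK (torus_mx_pi _ homA') (torus_mx_pi _ homA).
  by rewrite mulKVmx.
Qed.

(** The isomorphism of targets fixes 0 and is injective. This gives the uniqueness of the
    representative of an isogeny. *)
Lemma isogeny_equiv_kernel L L1 L2 (f1 : torus L -> torus L1)
    (f2 : torus L -> torus L2) :
  isogeny_equiv f1 f2 -> kernel f2 = kernel f1.
Proof.
move=> [g [[A gA] [h [_ gK _]]] f2E].
have g0 : g 0 = 0.
  by rewrite -(raddf0 (\pi_(torus L1))) gA mulmx0 raddf0.
apply/seteqP; split=> x; rewrite /kernel /= f2E /=.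
  by rewrite -{1}g0 => /(can_inj gK).
by move=> ->.
Qed.

End ComplexTori.

Lemma finite_cyclic (W : zmodType) (g : W) (n : nat) : (0 < n)%N ->
  g *+ n = 0 -> finite_set (range (fun m : int => g *~ m)).
Proof.
move=> n0 gn; apply: (@sub_finite_set _ _ ((fun k : nat => g *+ k) @` `I_n)).
  move=> _ [m _ <-]; have nz : n%:Z != 0 by rewrite -lt0n.
  have r_ge0 := modz_ge0 m nz; have r_lt := ltz_pmod m (n0 : 0 < n%:Z).
  rewrite (divz_eq m n); case: (m %% n)%Z r_ge0 r_lt => // r _ rn.
  by exists r => //; rewrite mulrzDr mulrC mulrzA -!pmulrn gn mul0rz add0r.
exact/finite_image/finite_II.
Qed.

(** * Coordinates on [l^-1 L / L], and the target modules as lines *)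

Section Directions.
Variables (K : fieldExtType rat) (K0 : {subfield K}).
Variables (l L1 L2 : omod K0) (tau : K) (ell : nat) (lam a b : K).
Hypotheses (ell_prime : prime ell) (l_prime : prime_ideal l).
Hypothesis l_norm : ideal_norm_eq l ell.
Hypotheses (l_lam : principal l lam) (L1_a : principal L1 a).
Hypotheses (L2_b : principal L2 b) (tauNK0 : tau \notin K0).
Local Notation OK0 := (ring_of_integers K0).
Local Notation L := (L1 + L2 *: tau)%OM.

(* Coordinates identify l^-1 L / L with the plane (OK0 / l)^2. *)
Definition coord (u v : K) : K := lam^-1 * (a * u + b * v * tau).

Lemma coordB u v u' v' :
  coord u v - coord u' v' = coord (u - u') (v - v').
Proof. by rewrite /coord; ring. Qed.

Lemma coordMn u v n : coord u v *+ n = coord (u *+ n) (v *+ n).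
Proof. by rewrite /coord; ring. Qed.

(** Two different values of the second coordinate would allow solving for [tau] inside [K0]. *)
Lemma coord_inj u v u' v' :
    u \in K0 -> v \in K0 -> u' \in K0 -> v' \in K0 ->
  coord u v = coord u' v' -> u = u' /\ v = v'.
Proof.
have [[_ lam0 _] [aK a0 _] [bK b0 _]] := And3 l_lam L1_a L2_b.
move=> uK vK uK' vK' /(mulfI (invr_neq0 lam0)) E.
have Etau : a * (u - u') = b * (v' - v) * tau.
  apply/subr0_eq; rewrite -(subrr (a * u' + b * v' * tau)) -{1}E; ring.
have v'v : v' - v = 0.
  apply/eqP; apply: contraR tauNK0 => v'v.
  have bv : b * (v' - v) != 0 by rewrite mulf_neq0.
  have -> : tau = (b * (v' - v))^-1 * (a * (u - u')).
    by rewrite Etau mulrA mulVf ?mul1r.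
  by rewrite rpredM ?rpredV // rpredM ?rpredB.
split; last exact/esym/subr0_eq.
apply/subr0_eq/(mulfI a0).
by rewrite Etau v'v mulr0 mul0r mulr0.
Qed.

(** Coordinates in [l = lam OK0] cancel the factor [lam^-1] of [coord]. *)
Lemma mem_base x :
  x \in L <-> exists u v, [/\ u \in l, v \in l & x = coord u v].
Proof.
have [[_ lam0 lP] [_ _ L1P] [_ _ L2P]] := And3 l_lam L1_a L2_b.
rewrite mem_addP; split.
  move=> [y [z [/L1P[u uO ->] /mem_scaleP[_ /L2P[v vO ->] ->] ->]]].
  exists (lam * u), (lam * v); split.
  - by apply/lP; exists u.
  - by apply/lP; exists v.
  - by rewrite /coord; field.
move=> [_ [_ [/lP[u uO ->] /lP[v vO ->] ->]]].
exists (a * u), (b * v * tau); split; first by apply/L1P; exists u.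
  by apply/mem_scaleP; exists (b * v) => //; apply/L2P; exists v.
by rewrite /coord; field.
Qed.

Lemma mem_inv_base x :
  x \in (l^-1 * L)%OM <-> exists u v, [/\ u \in OK0, v \in OK0 & x = coord u v].
Proof.
have [[_ lam0 lP] [_ _ L1P] [_ _ L2P]] := And3 l_lam L1_a L2_b.
rewrite (mem_mul_principal _ _ (principal_inv l_lam)); split.
  move=> [_ /mem_addP[y [z [/L1P[u uO ->] /mem_scaleP[_ /L2P[v vO ->] ->] ->]]]].
  by move=> ->; exists u, v.
move=> [u [v [uO vO ->]]]; exists (a * u + b * v * tau) => //.
apply/mem_addP; exists (a * u), (b * v * tau); split=> //.
  by apply/L1P; exists u.
by apply/mem_scaleP; exists (b * v) => //; apply/L2P; exists v.
Qed.

(* [Some r] is the line through (r, 1), and [None] the line through (1, 0). *)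
Definition on_line (d : option K) (u v : K) : bool :=
  if d is Some r then u - r * v \in l else v \in l.

(** [M] is the preimage in [l^-1 L] of the line [d]. As a condition on membership it applies
    directly to the target modules. *)
Definition line_omod (M : omod K0) (d : option K) : Prop :=
  forall x, x \in M <->
    exists u v, [/\ u \in OK0, v \in OK0, on_line d u v & x = coord u v].

Definition slope_in (d : option K) : Prop :=
  if d is Some r then r \in OK0 else True.

Lemma target_infty_line : line_omod (target_infty l L1 L2 tau) None.
Proof.
move=> x; have [[_ lam0 lP] [_ _ L1P] [_ _ L2P]] := And3 l_lam L1_a L2_b.
have [_ _ lL1P] := principal_mul (principal_inv l_lam) L1_a.
rewrite mem_addP; split.
  move=> [y [z [/lL1P[u uO ->] /mem_scaleP[_ /L2P[v vO ->] ->] ->]]].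
  exists u, (lam * v); have vl : lam * v \in l by apply/lP; exists v.
  split=> //; first by have [l_sub _ _] := l_prime; apply: l_sub.
  by rewrite /coord; field.
move=> [u [_ [uO _ /lP[v vO ->] ->]]].
exists (lam^-1 * a * u), (b * v * tau); split.
- by apply/lL1P; exists u.
- by apply/mem_scaleP; exists (b * v) => //; apply/L2P; exists v.
- by rewrite /coord; field.
Qed.

(** The element [a * u + lam^-1 * b * v * (tau + a / b * r)] is [coord (lam * u + r * v) v], whose
    first coordinate is [r * v] modulo [l]. *)
Lemma target_rho_line r : r \in OK0 ->
  line_omod (target_rho l L1 L2 tau (a / b * r)) (Some r).
Proof.
move=> rO x; have [[_ lam0 lP] [_ _ L1P] [_ b0 L2P]] := And3 l_lam L1_a L2_b.
have [_ _ lL2P] := principal_mul (principal_inv l_lam) L2_b.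
have [l_sub _ _] := l_prime.
rewrite mem_addP; split.
  move=> [y [z [/L1P[u uO ->] /mem_scaleP[_ /lL2P[v vO ->] ->] ->]]].
  have ul : lam * u \in l by apply/lP; exists u.
  exists (lam * u + r * v), v; split=> //;
    last by rewrite /coord; field; rewrite b0 lam0.
    by apply: ringD; [exact: l_sub | exact: ringM].
  by rewrite /on_line addrK.
move=> [u [v [uO vO /lP[w wO wE] ->]]].
have -> : u = lam * w + r * v by rewrite -wE subrK.
exists (a * w), (lam^-1 * b * v * (tau + a / b * r)); split.
- by apply/L1P; exists w.
- by apply/mem_scaleP; exists (lam^-1 * b * v) => //; apply/lL2P; exists v.
- by rewrite /coord; field; rewrite b0 lam0.
Qed.

(** Coordinates are unique, so membership can be tested on any given pair. *)
Lemma on_lineP d M u v : line_omod M d -> u \in OK0 -> v \in OK0 ->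
  coord u v \in M <-> on_line d u v.
Proof.
move=> MP uO vO; rewrite MP; split; last by exists u, v.
move=> [u' [v' [uO' vO' uv']]]; have S := @ring_sub _ K0.
by move=> /(coord_inj (S _ uO) (S _ vO) (S _ uO') (S _ vO'))[-> ->].
Qed.

Lemma line_base M d : slope_in d -> line_omod M d -> {subset L <= M}.
Proof.
move=> dO MP x /mem_base[u [v [ul vl ->]]]; have [l_sub _ _] := l_prime.
apply/(on_lineP MP); rewrite ?l_sub //.
by case: d dO {MP} => //= r rO; rewrite rpredB ?omodM.
Qed.

Lemma line_sub M d : line_omod M d -> {subset M <= (l^-1 * L)%OM}.
Proof.
by move=> MP x /MP[u [v [uO vO _ ->]]]; apply/mem_inv_base; exists u, v.
Qed.

(** Multiplication by [ell], an element of [l], sends integral coordinates into [l]. This supplies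
    the multiplier for the lemmas on larger lattices. *)
Lemma norm_mul_base x : x \in (l^-1 * L)%OM -> x *+ ell \in L.
Proof.
move=> /mem_inv_base[u [v [uO vO ->]]]; rewrite coordMn.
apply/mem_base; exists (u *+ ell), (v *+ ell); split=> //.
- by rewrite -mulr_natr omodM ?norm_mem.
- by rewrite -mulr_natr omodM ?norm_mem.
Qed.

Lemma on_line_eq r r' u v : v \in OK0 -> r - r' \in l ->
  on_line (Some r) u v = on_line (Some r') u v.
Proof.
move=> vO rr /=.
have -> : u - r' * v = u - r * v + v * (r - r') by ring.
by rewrite [RHS]rpredDr ?omodM.
Qed.

(** When [v] is nonzero modulo [l], [u] is congruent to an integer multiple of [v], and that integer
    serves as the slope. *)
Lemma line_through u v : u \in OK0 -> v \in OK0 ->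
  exists2 d, slope_in d & on_line d u v.
Proof.
move=> uO vO; case: (boolP (v \in l)) => vl; first by exists None.
have [n] := prime_multiples ell_prime l_prime l_norm vO uO vl.
exists (Some n%:R) => /=; last by rewrite mulr_natl.
exact/ringMn/ring1.
Qed.

Lemma line_generator d : slope_in d ->
  exists u v, [/\ u \in OK0, v \in OK0, on_line d u v
                & ~~ ((u \in l) && (v \in l))].
Proof.
have [_ l1 _] := l_prime; case: d => [r rO|_].
  exists r, 1; split; rewrite ?ring1 //=; first by rewrite mulr1 subrr rpred0.
  by rewrite (negPf l1) andbF.
by exists 1, 0; split; rewrite ?ring1 ?ring0 //= ?rpred0 ?(negPf l1).
Qed.

(** Over a prime field, any nonzero vector of a line generates it additively. For a finite slope
    [v0] is nonzero modulo [l], since otherwise [u0] would vanish too; [n] is read off from [v], and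
    the equation of the line settles [u]. *)
Lemma on_line_multiple d u0 v0 u v : slope_in d ->
    u0 \in OK0 -> v0 \in OK0 -> on_line d u0 v0 ->
    ~~ ((u0 \in l) && (v0 \in l)) ->
    u \in OK0 -> v \in OK0 -> on_line d u v ->
  exists n : nat, u - u0 *+ n \in l /\ v - v0 *+ n \in l.
Proof.
move=> dO uO0 vO0 d0 nz uO vO duv; case: d dO d0 duv => [r rO|_] /= d0 duv.
  have v0l : v0 \notin l.
    apply: contra nz => v0l; rewrite v0l andbT.
    by rewrite -(subrK (r * v0) u0) rpredD ?omodM.
  have [n vn] := prime_multiples ell_prime l_prime l_norm vO0 vO v0l.
  exists n; split=> //.
  have -> : u - u0 *+ n = u - r * v + r * (v - v0 *+ n) - (u0 - r * v0) *+ n.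
    by ring.
  by rewrite rpredB ?rpredMn // rpredD ?omodM.
rewrite d0 andbT in nz.
have [n un] := prime_multiples ell_prime l_prime l_norm uO0 uO nz.
by exists n; split=> //; rewrite rpredB ?rpredMn.
Qed.

Lemma rho_numer_slope rho :
  rho \in rho_numer L1 L2 <-> exists2 r, r \in OK0 & rho = a / b * r.
Proof. by have [_ _ P] := principal_mul L1_a (principal_inv L2_b); apply: P. Qed.

Lemma rho_denom_slope rho :
  rho \in rho_denom l L1 L2 <-> exists2 s, s \in l & rho = a / b * s.
Proof.
have [_ _ lP] := l_lam.
have [_ _ P] := principal_mul l_lam (principal_mul L1_a (principal_inv L2_b)).
rewrite P; split=> [[u uO ->]|[_ /lP[u uO ->] ->]]; last first.
  by exists u => //; ring.
by exists (lam * u); [apply/lP; exists u | ring].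
Qed.

(** [isog_index] also contains classes of elements outside [rho_numer]; the slope is integral for
    the indices in [isog_indices]. *)
Definition slope (i : isog_index l L1 L2) : option K :=
  if i is Some c then Some ((a / b)^-1 * repr c) else None.

Lemma ab_neq0 : a / b != 0.
Proof.
by have [[_ a0 _] [_ b0 _]] := conj L1_a L2_b; rewrite mulf_neq0 ?invr_neq0.
Qed.

Lemma index_slope_in i : isog_indices l L1 L2 i -> slope_in (slope i).
Proof.
have [l_sub _ _] := l_prime.
move=> [->|[c [rho /rho_numer_slope[r rO rhoE] <-] <-]] //.
set c' := \pi_ _ rho.
(* The chosen representative may differ from [rho], but only by [a / b] times an element of [l],
   which keeps the slope integral. *)
have : repr c' - rho \in rho_denom l L1 L2 by apply/pi_quotP; rewrite reprK.
move=> /rho_denom_slope[s sl /(canRL (subrK _))]; rewrite rhoE -mulrDr /= => ->.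
by rewrite mulKf ?ab_neq0 //; apply: ringD => //; exact: l_sub.
Qed.

Lemma target_line i :
  isog_indices l L1 L2 i -> line_omod (target tau i) (slope i).
Proof.
move=> /index_slope_in; case: i => [c|_] /=; last exact: target_infty_line.
by move=> /target_rho_line; rewrite mulVKf ?ab_neq0.
Qed.

(** The slope of the index found agrees with [d] only modulo [l], so the lines are compared rather
    than the slopes. *)
Lemma slope_index d : slope_in d -> exists2 i, isog_indices l L1 L2 i &
  forall u v, v \in OK0 -> on_line (slope i) u v = on_line d u v.
Proof.
case: d => [r rO|_]; last by exists None; [left | ].
pose c := \pi_(Quotient.quot (rho_denom l L1 L2)) (a / b * r).
exists (Some c).
  right; exists c => //; exists (a / b * r) => //.
  by apply/rho_numer_slope; exists r.
move=> u v vO; apply: on_line_eq => //.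
have : repr c - a / b * r \in rho_denom l L1 L2 by apply/pi_quotP; rewrite reprK.
move=> /rho_denom_slope[s sl sE].
suff -> : (a / b)^-1 * repr c - r = s by [].
apply: (mulfI ab_neq0); rewrite -sE mulrBr mulrA divff ?ab_neq0 //.
by rewrite mul1r.
Qed.

(** The point [(r, 1)] on the line of slope [r] detects congruence of two finite slopes, and
    [(1, 0)] separates infinity from the finite ones. *)
Lemma slope_inj i j : isog_indices l L1 L2 i -> isog_indices l L1 L2 j ->
  (forall u v, u \in OK0 -> v \in OK0 ->
     on_line (slope i) u v = on_line (slope j) u v) -> i = j.
Proof.
move=> /index_slope_in iO /index_slope_in jO; have [_ l1 _] := l_prime.
case: i j iO jO => [c|] [c'|] //= cO cO' E.
- have := E _ 1 cO (ring1 K0); rewrite !mulr1 subrr rpred0 => /esym cl.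
  congr Some; rewrite -[c]reprK -[c']reprK; apply/pi_quotP/rho_denom_slope.
  exists ((a / b)^-1 * (repr c - repr c')); first by rewrite mulrBr.
  by rewrite mulVKf ?ab_neq0.
- have := E 1 0 (ring1 K0) (ring0 K0).
  by rewrite mulr0 subr0 rpred0 (negPf l1).
- have := E 1 0 (ring1 K0) (ring0 K0).
  by rewrite mulr0 subr0 rpred0 (negPf l1).
Qed.

Lemma target_rho_eq : {in rho_numer L1 L2 &, forall rho rho' : K,
  \pi_(Quotient.quot (rho_denom l L1 L2)) rho =
  \pi_(Quotient.quot (rho_denom l L1 L2)) rho' ->
  target_rho l L1 L2 tau rho =i target_rho l L1 L2 tau rho'}.
Proof.
move=> _ _ /rho_numer_slope[r rO ->] /rho_numer_slope[r' rO' ->].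
move=> /pi_quotP /rho_denom_slope[s sl]; rewrite -mulrBr => /(mulfI ab_neq0) rs x.
have P := target_rho_line rO; have P' := target_rho_line rO'.
apply/idP/idP.
  move=> /P[u [v [uO vO duv ->]]]; apply/P'.
  by exists u, v; split=> //; rewrite -(@on_line_eq r) ?rs.
move=> /P'[u [v [uO vO duv ->]]]; apply/P.
by exists u, v; split=> //; rewrite (@on_line_eq r r') ?rs.
Qed.

End Directions.

(** * Transport of submodules of [K] to subgroups of the torus *)

Section PhiLattice.
Variables (R : realType) (K : fieldExtType rat) (K0 : {subfield K}).
Variable phi : 'I_2 -> {rmorphism K -> R[i]}.
Implicit Types L M : omod K0.

Lemma Phi_is_zmod_morphism : zmod_morphism (Phi phi).
Proof. by move=> x y; apply/colP => j; rewrite !mxE rmorphB. Qed.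

HB.instance Definition _ :=
  GRing.isZmodMorphism.Build K 'cV[R[i]]_2 (Phi phi) Phi_is_zmod_morphism.

Lemma Phi_inj : injective (Phi phi).
Proof. by move=> x y /colP/(_ 0); rewrite !mxE => /fmorph_inj. Qed.

Lemma Phi_latticeP L z : reflect (exists2 x, x \in L & z = Phi phi x)
  (z \in Phi_lattice phi L).
Proof. by rewrite -topredE; apply: (iffP (asboolP _)). Qed.

Lemma mem_Phi L x : (Phi phi x \in Phi_lattice phi L) = (x \in L).
Proof.
by apply/Phi_latticeP/idP => [[y yL /Phi_inj->]|xL] //; exists x.
Qed.

Lemma Phi_lattice_sub L M : {subset L <= M} ->
  {subset Phi_lattice phi L <= Phi_lattice phi M}.
Proof. by move=> LM _ /Phi_latticeP[x xL ->]; rewrite mem_Phi LM. Qed.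

(** Since [Phi] is injective, this is the correspondence between modules above [L] and their
    quotients by [L]. *)
Lemma Phi_quotient_sub L M M' : {subset L <= M} -> {subset L <= M'} ->
  Phi_quotient phi M L `<=` Phi_quotient phi M' L <-> {subset M <= M'}.
Proof.
move=> LM LM'; split=> [S x xM|S _ [_ /Phi_latticeP[x xM ->] <-]]; last first.
  by exists (Phi phi x) => //=; rewrite mem_Phi S.
have /S[_ /Phi_latticeP[y yM' ->] /pi_quotP] :
    Phi_quotient phi M L (\pi_(torus (Phi_lattice phi L)) (Phi phi x)).
  by exists (Phi phi x) => //=; rewrite mem_Phi.
rewrite -raddfB mem_Phi => /LM' yx.
by rewrite -(subKr y x) rpredB.
Qed.

End PhiLattice.

(** * Lines and nontrivial cyclic subgroups *)

Section Kernels.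
Variables (R : realType) (K : fieldExtType rat) (K0 : {subfield K}).
Variable phi : 'I_2 -> {rmorphism K -> R[i]}.
Variables (l L1 L2 : omod K0) (tau : K) (ell : nat) (lam a b : K).
Hypotheses (ell_prime : prime ell) (l_prime : prime_ideal l).
Hypothesis l_norm : ideal_norm_eq l ell.
Hypotheses (l_lam : principal l lam) (L1_a : principal L1 a).
Hypotheses (L2_b : principal L2 b) (tauNK0 : tau \notin K0).
Local Notation OK0 := (ring_of_integers K0).
Local Notation L := (L1 + L2 *: tau)%OM.
Local Notation T := (torus (Phi_lattice phi L)).
Local Notation coord := (coord tau lam a b).
Local Notation line_omod := (line_omod l tau lam a b).
Local Notation base_of d dO MP :=
  (line_base l_prime l_lam L1_a L2_b tauNK0 (d := d) dO MP).

(** By [on_line_multiple], each point of the line is an integer multiple of [(u, v)] up to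
    coordinates in [l], which vanish modulo [L]. *)
Lemma line_cyclic d M u v : slope_in K0 d -> line_omod M d ->
    u \in OK0 -> v \in OK0 -> on_line l d u v -> ~~ ((u \in l) && (v \in l)) ->
  Phi_quotient phi M L = range (fun n : int => \pi_T (Phi phi (coord u v)) *~ n).
Proof.
move=> dO MP uO vO duv nz.
have baseP := mem_base tau l_lam L1_a L2_b.
have gM : coord u v \in M by apply/MP; exists u, v.
apply/seteqP; split=> [_ [_ /Phi_latticeP[x /MP[u' [v' [uO' vO' duv' ->]]] ->] <-]|].
  have [n [un vn]] :=
    on_line_multiple ell_prime l_prime l_norm dO uO vO duv nz uO' vO' duv'.
  exists (n%:Z) => //; rewrite -pmulrn -!raddfMn; apply/esym/pi_quotP.
  rewrite -raddfB mem_Phi coordMn coordB; apply/baseP.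
  by exists (u' - u *+ n), (v' - v *+ n).
move=> _ [n _ <-]; exists (Phi phi (coord u v *~ n)).
  by rewrite /= mem_Phi rpredMz.
by rewrite !raddfMz.
Qed.

Lemma line_nontrivial_cyclic d M : slope_in K0 d -> line_omod M d ->
  nontrivial_cyclic_subgroups (Phi_quotient phi (l^-1 * L)%OM L)
    (Phi_quotient phi M L).
Proof.
move=> dO MP; have LM := base_of d dO MP.
have [u [v [uO vO duv nz]]] := line_generator l_prime dO.
have ML := line_sub l_lam L1_a L2_b MP.
split.
- by eexists; exact: line_cyclic dO MP uO vO duv nz.
- by apply/Phi_quotient_sub => // x /LM /ML.
(* If the quotient were trivial, [coord u v] would lie in [L], and by uniqueness both coordinates
   would be in [l]. *)
- move=> H0; have gM : coord u v \in M by apply/MP; exists u, v.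
  have : Phi_quotient phi M L (\pi_T (Phi phi (coord u v))).
    by exists (Phi phi (coord u v)) => //=; rewrite mem_Phi.
  rewrite H0 => /quot_eq0P; rewrite mem_Phi.
  move=> /(mem_base tau l_lam L1_a L2_b)[u' [v' [ul vl]]].
  have [l_sub _ _] := l_prime; have S := @ring_sub _ K0.
  move=> /(coord_inj l_lam L1_a L2_b tauNK0 (S _ uO) (S _ vO)).
  move=> /(_ (S _ (l_sub _ ul)) (S _ (l_sub _ vl)))[uE vE].
  by move: nz; rewrite uE vE ul vl.
Qed.

(** The line is the one through the coordinates of a generator of [H]. They are not both in [l],
    since otherwise [H] would be trivial. *)
Lemma nontrivial_cyclic_line H :
  nontrivial_cyclic_subgroups (Phi_quotient phi (l^-1 * L)%OM L) H ->
  exists2 d, slope_in K0 d &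
    forall M, line_omod M d -> H = Phi_quotient phi M L.
Proof.
move=> [[g HE] HG H0].
have /HG[_ /Phi_latticeP[x xG ->] gE] : H g by rewrite HE; exists 1.
have [u [v [uO vO xE]]] := iffLR (mem_inv_base tau l_lam L1_a L2_b x) xG.
rewrite {x xG}xE in gE.
have [d dO duv] := line_through ell_prime l_prime l_norm uO vO.
exists d => // M MP; rewrite HE -gE; apply/esym.
apply: line_cyclic dO MP uO vO duv _; apply/negP => /andP[ul vl].
apply: H0; rewrite HE -gE.
have -> : \pi_T (Phi phi (coord u v)) = 0.
  apply/quot_eq0P; rewrite mem_Phi; apply/(mem_base tau l_lam L1_a L2_b).
  by exists u, v.
apply/seteqP; split=> [_ [n _ <-]|x ->]; first by rewrite mul0rz.
by exists 0; rewrite ?mul0rz.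
Qed.

End Kernels.

Theorem proposition12 (R : realType) (K : fieldExtType rat)
    (K0 : {subfield K}) (phi : 'I_2 -> {rmorphism K -> R[i]})
    (ell : nat) (l L1 L2 : omod K0) (tau : K) (O : {pred K})
    (hK : primitive_quartic_CM_field R K)
    (hK0 : real_quadratic R K0)
    (hclass : class_number_eq K0 1)
    (hphi : CM_type phi)
    (hell : prime ell)
    (hl : prime_ideal l)
    (hnorm : ideal_norm_eq l ell)
    (hL1 : fractional_ideal L1)
    (hL2 : fractional_ideal L2)
    (htau : tau \notin K0)
    (hO : is_order O)
    (hOK0 : {subset ring_of_integers K0 <= O}) :
  let L : omod K0 := (L1 + L2 *: tau)%OM in
  forall (hA : abelian_surface (Phi_lattice phi L))
         (hCM : has_CM_by (Phi_lattice phi L) O),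
  let indices := isog_indices l L1 L2 in
  let I := @isog K K0 l L1 L2 tau R phi L in
  let subgroups :=
    nontrivial_cyclic_subgroups (Phi_quotient phi (l^-1 * L)%OM L) in
  [/\ (* I_rho depends only on the class of rho *)
      {in rho_numer L1 L2 &, forall rho rho' : K,
         \pi_(Quotient.quot (rho_denom l L1 L2)) rho =
         \pi_(Quotient.quot (rho_denom l L1 L2)) rho' ->
         target_rho l L1 L2 tau rho =i target_rho l L1 L2 tau rho'},
      (* each I_i is the isogeny induced by the identity of C^2 *)
      (forall i, indices i ->
         isogeny (I i) /\
         forall z, I i (\pi_(torus (Phi_lattice phi L)) z) =
           \pi_(torus (Phi_lattice phi (target tau i))) z),
      set_bij indices subgroups (fun i => kernel (I i))
    & forall (L' : zmodClosed 'cV[R[i]]_2)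
             (f : torus (Phi_lattice phi L) -> torus L'),
        isogeny f -> subgroups (kernel f) ->
        exists! i, indices i /\ isogeny_equiv (I i) f].
Proof.
move=> L hA hCM indices I subgroups.
have [lam l_lam] :=
  class_number_one_principal hclass (prime_fractional hell hl hnorm).
have [a L1_a] := class_number_one_principal hclass hL1.
have [b L2_b] := class_number_one_principal hclass hL2.
have i_line i : indices i ->
    slope_in K0 (slope a b i) /\
    line_omod l tau lam a b (target tau i) (slope a b i).
  move=> hi; split; first exact: (index_slope_in hl l_lam L1_a L2_b).
  exact: target_line.
have base_sub i : indices i -> {subset L <= target tau i}.
  by move=> /i_line[dO MP]; apply: line_base dO MP.
have lattice_sub i (hi : indices i) := Phi_lattice_sub (phi := phi) (base_sub i hi).
have kerE i : indices i -> kernel (I i) = Phi_quotient phi (target tau i) L.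
  by move=> hi; exact: kernel_torus_id (lattice_sub i hi).
have norm_sub i : indices i -> forall z,
    z \in Phi_lattice phi (target tau i) -> z *+ ell \in Phi_lattice phi L.
  move=> /i_line[_ MP] _ /Phi_latticeP[x xM ->]; rewrite -raddfMn mem_Phi.
  apply: (norm_mul_base hnorm l_lam L1_a L2_b).
  exact: (line_sub l_lam L1_a L2_b MP).
have ker_sub i : indices i -> subgroups (kernel (I i)).
  move=> hi; rewrite kerE //; have [dO MP] := i_line i hi.
  exact: (line_nontrivial_cyclic phi hell hl hnorm l_lam L1_a L2_b htau dO MP).
(* Equal kernels give target modules with the same elements, hence the same line, hence the same
   index. *)
have ker_inj i j : indices i -> indices j ->
    kernel (I i) = kernel (I j) -> i = j.
  move=> hi hj; rewrite !kerE // => ij.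
  have [dO MP] := i_line i hi; have [dO' MP'] := i_line j hj.
  apply: (slope_inj hl l_lam L1_a L2_b hi hj) => u v uO vO.
  have Di := on_lineP l_lam L1_a L2_b htau MP uO vO.
  have Dj := on_lineP l_lam L1_a L2_b htau MP' uO vO.
  have ij1 : {subset target tau i <= target tau j}.
    by apply/(Phi_quotient_sub phi (base_sub i hi) (base_sub j hj)); rewrite ij.
  have ij2 : {subset target tau j <= target tau i}.
    by apply/(Phi_quotient_sub phi (base_sub j hj) (base_sub i hi)); rewrite ij.
  by apply/idP/idP => [/Di/ij1/Dj|/Dj/ij2/Di].
have ker_surj H : subgroups H -> exists2 i, indices i & kernel (I i) = H.
  move=> /(nontrivial_cyclic_line hell hl hnorm l_lam L1_a L2_b)[d dO dH].
  have [i hi id] := slope_index l_lam L1_a L2_b dO.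
  exists i => //; rewrite kerE //; apply/esym/dH => x.
  have [_ ->] := i_line i hi.
  by split=> -[u [v [uO vO uv ->]]]; exists u, v; split=> //; move: uv; rewrite id.
split.
- exact: (target_rho_eq tau hl l_lam L1_a L2_b).
- move=> i hi; split=> [|z]; last exact: torus_id_pi (lattice_sub i hi).
  apply: (torus_id_isogeny (lattice_sub i hi) (prime_gt0 hell)) => //.
    exact: norm_sub.
  (* The kernel is finite because it is cyclic with a generator killed by [ell]. *)
  have [[g gE] _ _] := ker_sub i hi.
  rewrite gE; apply: (finite_cyclic (prime_gt0 hell)).
  have : kernel (I i) g by rewrite gE; exists 1.
  rewrite kerE // => -[z zM <-]; rewrite -raddfMn; apply/quot_eq0P.
  exact: norm_sub zM.
- split; [exact: ker_sub | | ].
    by move=> i j; rewrite !inE; exact: ker_inj.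
  by move=> H /ker_surj[i hi <-]; exists i.
(* The index is the one whose kernel is that of [f]; any other suitable index has the same kernel
   and so coincides with it. *)
- move=> L' f [_ _ f_hom _ _] /ker_surj[i hi ker_i].
  exists i; split=> [|j [hj /isogeny_equiv_kernel ker_j]]; last first.
    by apply: ker_inj => //; rewrite ker_i.
  split=> //; apply: isogeny_equiv_torus_id => //.
  + exact: lattice_sub.
  + have [fL _] := hA; apply: full_lattice_sup fL.
    * exact: lattice_sub.
    * exact: prime_gt0 hell.
    * exact: norm_sub.
Qed.
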